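(* Let $M$ be a positive monoid consisting of algebraic numbers. Then the semirings $E(M)$ and $\mathbb{N}_0[M]$ are isomorphic.
   Context: $\mathbb{N}_0$ denotes the set of nonnegative integers. A positive monoid is an additive submonoid of $\mathbb{R}_{\ge 0}$. $E(M) = \langle e^m \mid m \in M\rangle$ is the additive submonoid of $\mathbb{R}_{\ge 0}$ generated by $\{e^m \mid m \in M\}$, where $e$ is the base of the natural logarithm; it contains $1$ and is closed under multiplication, and is a semiring under the usual addition and multiplication of real numbers. $\mathbb{N}_0[M]$ is the monoid semiring of $M$ over the naturals: the semiring of formal polynomial expressions $\sum_{i=1}^k c_i x^{m_i}$ in an indeterminate $x$ with coefficients $c_i \in \mathbb{N}_0$ and exponents $m_i \in M$ (finitely many terms, including the zero polynomial), with the usual addition of polynomials and the multiplication determined by distributivity and $x^{m} \cdot x^{m'} = x^{m+m'}$. A semiring isomorphism is a bijection preserving addition, multiplication, $0$ and $1$. *)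

(* Defs.v *)
From HB Require Import structures.
From mathcomp Require Import all_boot all_order all_algebra finmap.
From mathcomp Require Import boolp classical_sets reals sequences exp.

Set Implicit Arguments.
Unset Strict Implicit.
Unset Printing Implicit Defensive.

Import Order.TTheory GRing.Theory Num.Theory.

Local Open Scope fset_scope.
Local Open Scope ring_scope.

(* An element of S[K], for an additively written monoid K, is the finitely
   supported function sending an exponent to its coefficient. *)
Definition monoidSemiring (S : comNzSemiRingType) (K : nmodType) : Type :=
  {fsfun K -> S with 0}.

Section MonoidSemiring.
Variables (S : comNzSemiRingType) (K : nmodType).
Local Notation SK := (monoidSemiring S K).

HB.instance Definition _ := Choice.on SK.

Implicit Types f g h : SK.

Definition ms_coef f : K -> S := fun k => (f : {fsfun K -> S with 0}) k.
Definition ms_supp f : {fset K} := finsupp (f : {fsfun K -> S with 0}).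

(* c x^k *)
Definition ms_monom (c : S) (k : K) : SK :=
  [fsfun i in [fset k] => c | 0]%fset.

Definition ms_zero : SK := [fsfun].
Definition ms_one : SK := ms_monom 1 0.
Definition ms_add f g : SK :=
  [fsfun k in ms_supp f `|` ms_supp g => ms_coef f k + ms_coef g k | 0].

Lemma ms_ext f g : ms_coef f =1 ms_coef g -> f = g.
Proof. by move=> fg; apply/fsfunP. Qed.

Lemma ms_coef_out f k : k \notin ms_supp f -> ms_coef f k = 0.
Proof. exact: fsfun_dflt. Qed.

Lemma ms_coef_monom c k i : ms_coef (ms_monom c k) i = if i == k then c else 0.
Proof. by rewrite /ms_coef fsfunE inE. Qed.

Lemma ms_coef_zero i : ms_coef ms_zero i = 0.
Proof. by rewrite /ms_coef fsfunE. Qed.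

Lemma ms_coef_add f g i : ms_coef (ms_add f g) i = ms_coef f i + ms_coef g i.
Proof.
rewrite {1}/ms_coef fsfunE in_fsetU.
case: (boolP (i \in ms_supp f)) => //= fi.
case: (boolP (i \in ms_supp g)) => //= gi.
by rewrite !ms_coef_out // addr0.
Qed.

Fact ms_addA : associative ms_add.
Proof. by move=> f g h; apply: ms_ext => i; rewrite !ms_coef_add addrA. Qed.

Fact ms_addC : commutative ms_add.
Proof. by move=> f g; apply: ms_ext => i; rewrite !ms_coef_add addrC. Qed.

Fact ms_add0 : left_id ms_zero ms_add.
Proof.
by move=> f; apply: ms_ext => i; rewrite ms_coef_add ms_coef_zero add0r.
Qed.

HB.instance Definition _ := GRing.isNmodule.Build SK ms_addA ms_addC ms_add0.

(* (sum_i f_i x^i) (sum_j g_j x^j) = sum_(i, j) f_i g_j x^(i + j) *)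
Definition ms_mul f g : SK :=
  \sum_(i <- ms_supp f) \sum_(j <- ms_supp g)
     ms_monom (ms_coef f i * ms_coef g j) (i + j).

Lemma ms_coef0 i : ms_coef 0 i = 0. Proof. exact: ms_coef_zero. Qed.

Lemma ms_coefD f g i : ms_coef (f + g) i = ms_coef f i + ms_coef g i.
Proof. exact: ms_coef_add. Qed.

Lemma ms_coef_sum (I : Type) (r : seq I) (P : pred I) (F : I -> SK) i :
  ms_coef (\sum_(j <- r | P j) F j) i = \sum_(j <- r | P j) ms_coef (F j) i.
Proof.
by apply: (big_morph (fun f => ms_coef f i)) => [f g|];
  rewrite ?ms_coefD ?ms_coef0.
Qed.

Lemma ms_monom0 k : ms_monom 0 k = 0.
Proof.
by apply: ms_ext => i; rewrite ms_coef_monom ms_coef0; case: ifP.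
Qed.

Lemma ms_monomD c d k : ms_monom (c + d) k = ms_monom c k + ms_monom d k.
Proof.
apply: ms_ext => i; rewrite ms_coefD !ms_coef_monom.
by case: ifP => //; rewrite addr0.
Qed.

Lemma ms_mulwE (A B : {fset K}) f g :
  ms_supp f `<=` A -> ms_supp g `<=` B ->
  ms_mul f g = \sum_(i <- A) \sum_(j <- B)
                 ms_monom (ms_coef f i * ms_coef g j) (i + j).
Proof.
move=> fA gB; rewrite /ms_mul.
rewrite (big_fset_incl _ fA) => [|i _ /ms_coef_out ->]; last first.
  by rewrite big1 // => j _; rewrite mul0r ms_monom0.
apply: eq_bigr => i _.
by rewrite (big_fset_incl _ gB) // => j _ /ms_coef_out ->; rewrite mulr0 ms_monom0.
Qed.

Fact ms_mulC : commutative ms_mul.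
Proof.
move=> f g; rewrite /ms_mul exchange_big /=.
by apply: eq_bigr => i _; apply: eq_bigr => j _; rewrite mulrC addrC.
Qed.

Fact ms_mulDl : left_distributive ms_mul +%R.
Proof.
move=> f g h.
pose A := ms_supp f `|` ms_supp g `|` ms_supp (f + g).
have fA : ms_supp f `<=` A by rewrite /A -fsetUA fsubsetUl.
have gA : ms_supp g `<=` A by rewrite /A fsetUAC fsubsetUr.
have fgA : ms_supp (f + g) `<=` A by rewrite /A fsubsetUr.
rewrite (ms_mulwE fA (fsubset_refl _)) (ms_mulwE gA (fsubset_refl _)).
rewrite (ms_mulwE fgA (fsubset_refl _)) -big_split /=; apply: eq_bigr => i _.
rewrite -big_split /=; apply: eq_bigr => j _.
by rewrite ms_coefD mulrDl ms_monomD.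
Qed.

Fact ms_mul0 : left_zero 0 ms_mul.
Proof.
move=> f; rewrite /ms_mul big1 // => i _.
by rewrite big1 // => j _; rewrite ms_coef0 mul0r ms_monom0.
Qed.

Lemma ms_mul_monom c d k l :
  ms_mul (ms_monom c k) (ms_monom d l) = ms_monom (c * d) (k + l).
Proof.
have H e i : ms_supp (ms_monom e i) `<=` [fset i].
  apply/fsubsetP => j; rewrite inE mem_finsupp; apply: contra_neqT => ji.
  by have := ms_coef_monom e i j; rewrite (negPf ji).
by rewrite (ms_mulwE (H _ _) (H _ _)) !big_seq_fset1 !ms_coef_monom !eqxx.
Qed.

Lemma ms_expand f : f = \sum_(k <- ms_supp f) ms_monom (ms_coef f k) k.
Proof.
apply: ms_ext => i; rewrite ms_coef_sum.
under eq_bigr do rewrite ms_coef_monom eq_sym.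
rewrite -big_mkcond /= -big_filter.
case: (boolP (i \in ms_supp f)) => fi.
  by rewrite filter_pred1_uniq ?fset_uniq // big_seq1.
rewrite ms_coef_out // big_filter big1_seq // => k /andP[/eqP-> ].
by rewrite (negPf fi).
Qed.

Lemma ms_ind (P : SK -> Prop) :
  P 0 -> (forall f g, P f -> P g -> P (f + g)) ->
  (forall c k, P (ms_monom c k)) -> forall f, P f.
Proof. by move=> P0 PD Pm f; rewrite (ms_expand f); apply: big_ind. Qed.

Fact ms_mul1 : left_id ms_one ms_mul.
Proof.
elim/ms_ind => [|f g IHf IHg|c k].
- by rewrite ms_mulC ms_mul0.
- by rewrite ms_mulC ms_mulDl !(ms_mulC _ ms_one) IHf IHg.
- by rewrite ms_mul_monom mul1r add0r.
Qed.

Fact ms_mulA : associative ms_mul.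
Proof.
have mulDr f g h : ms_mul f (g + h) = ms_mul f g + ms_mul f h.
  by rewrite ms_mulC ms_mulDl !(ms_mulC f).
have mulr0 f : ms_mul f 0 = 0 by rewrite ms_mulC ms_mul0.
move=> f g h; elim/ms_ind: f => [|f f' IHf IHf'|c k].
- by rewrite !ms_mul0.
- by rewrite !ms_mulDl IHf IHf'.
elim/ms_ind: g => [|g g' IHg IHg'|d l].
- by rewrite !(mulr0, ms_mul0).
- by rewrite !(ms_mulDl, mulDr) IHg IHg'.
elim/ms_ind: h => [|h h' IHh IHh'|e m].
- by rewrite !mulr0.
- by rewrite !mulDr IHh IHh'.
by rewrite !ms_mul_monom mulrA addrA.
Qed.

Fact ms_oner_neq0 : ms_one != 0 :> SK.
Proof.
apply/eqP => /(congr1 (fun f => ms_coef f 0)) /eqP.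
by rewrite ms_coef_monom eqxx ms_coef0 (negPf (oner_neq0 _)).
Qed.

HB.instance Definition _ :=
  GRing.Nmodule_isComNzSemiRing.Build SK
    ms_mulA ms_mulC ms_mul1 ms_mulDl ms_mul0 ms_oner_neq0.

End MonoidSemiring.

Record submonoid (V : nmodType) (M : addrClosed V) : Type :=
  Submonoid { submonoid_val :> V; submonoid_valP : submonoid_val \in M }.

Section SubmonoidNmod.
Variables (V : nmodType) (M : addrClosed V).
HB.instance Definition _ := [isSub for @submonoid_val V M].
HB.instance Definition _ := [Choice of submonoid M by <:].
HB.instance Definition _ :=
  GRing.SubChoice_isSubNmodule.Build V [in M] (submonoid M) (rpred0D M).
End SubmonoidNmod.

Local Open Scope classical_set_scope.

Definition gen_submonoid (V : nmodType) (A : set V) : set V :=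
  smallest [set N | N 0 /\ forall x y, N x -> N y -> N (x + y)] A.

Section ExpSemiring.
Variables (R : realType) (M : addrClosed R).

(* Generating inside R rather than inside the nonnegative reals gives the same
   submonoid, since every expR m is positive. *)
Definition expset : set R := gen_submonoid [set expR m | m in [set` M]].

Definition in_expset : {pred R} := fun x => x \in expset.

Fact expset0 : expset 0.
Proof. by move=> N [[]]. Qed.

Fact expsetD x y : expset x -> expset y -> expset (x + y).
Proof.
move=> xE yE N NP; have [[_ ND] _] := NP.
by apply: ND; [apply: xE | apply: yE].
Qed.

Fact expset_exp m : m \in M -> expset (expR m).
Proof. by move=> mM N [_ MN]; apply: MN; exists m. Qed.

Fact expset1 : expset 1.
Proof. by rewrite -expR0; apply: expset_exp; apply: rpred0. Qed.

Fact expsetM x y : expset x -> expset y -> expset (x * y).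
Proof.
move=> xE yE.
apply: (xE [set x | expset (x * y)]); split=> [|_ [m mM <-]] /=.
  split; first by rewrite mul0r; apply: expset0.
  by move=> a b aE bE; rewrite mulrDl; apply: expsetD.
apply: (yE [set y | expset (expR m * y)]); split=> [|_ [n nM <-]] /=.
  split; first by rewrite mulr0; apply: expset0.
  by move=> a b aE bE; rewrite mulrDr; apply: expsetD.
by rewrite -expRD; apply: expset_exp; apply: rpredD.
Qed.

Fact expset_semiring_closed : semiring_closed in_expset.
Proof.
split; split; rewrite /in_expset ?inE.
- exact: expset0.
- by move=> x y; rewrite !inE; apply: expsetD.
- exact: expset1.
- by move=> x y; rewrite !inE; apply: expsetM.
Qed.

HB.instance Definition _ :=
  GRing.isSemiringClosed.Build R in_expset expset_semiring_closed.

Record expSemiring : Type :=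
  ExpSemiring { expSemiring_val :> R;
                expSemiring_valP : expSemiring_val \in in_expset }.

HB.instance Definition _ := [isSub for expSemiring_val].
HB.instance Definition _ := [Choice of expSemiring by <:].
HB.instance Definition _ :=
  [SubChoice_isSubComNzSemiRing of expSemiring by <:].

End ExpSemiring.

Definition semiring_isomorphic (A B : pzSemiRingType) : Prop :=
  exists f : {rmorphism A -> B}, bijective f.

(* Main.v *)
Require Import Defs.
From HB Require Import structures.
From mathcomp Require Import all_boot all_order all_algebra finmap.
From mathcomp Require Import fingroup perm separable.
From mathcomp Require Import boolp classical_sets reals sequences exp.
From mathcomp Require Import complex ring.
From mathcomp Require mpoly topology normedtype.

(** The map sending [x^m] to [exp m] is a semiring morphism from [N_0[M]] to
    [E(M)], by the exponential law.  It is onto because its image is an additive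
    submonoid containing the generators of [E(M)].  It is injective because the
    exponentials of distinct algebraic numbers are linearly independent over the
    integers: this is the Lindemann-Weierstrass theorem, proved here for real
    exponents as [lindemann_weierstrass_real].

    Suppose that [\sum_i b_i exp a_i = 0] with the [a_i] real, algebraic and
    distinct, and with integers [b_i] not all zero.  Exponential sums are handled
    as elements [f] of the monoid semiring [Z[C]] of the additive group of complex
    numbers, through their moments [\sum_g f_g g^n].

    Complete the [a_i] to the list [r_1, ..., r_N] of all roots of a separable
    integer polynomial, and form [F], the product over all permutations [s] of
    [\sum_i b_i x^(r_(s i))], and then [F] times its reflection [x^g -> x^(-g)].
    The moments of this product are symmetric in the [r_i], hence rational with
    denominators dividing powers of a fixed integer
    ([moment_conj_square_int]).  As [Z[C]] has no zero divisors, [F] is nonzero,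
    so that the constant term of the product, the sum of the squares of the
    coefficients of [F], is not zero either ([conj_square_coef0]).

    One of the factors is the given relation.  The other factors involve complex
    exponents, but no complex exponential is needed: the vanishing of a sum is
    expressed by the rate at which the truncations of its exponential series tend
    to zero, and this property passes from a factor to a product
    ([exp_vanishesM]).

    Finally Hermite's argument applies to the product.  For
    [Q = X^(p - 1) T^p], with [T] an integer polynomial killing the nonzero
    exponents and [p] a large prime, the sum of all derivatives of [Q] over the
    exponents is, up to denominators, a nonzero multiple of [(p - 1)!], while the
    vanishing of the exponential sum bounds it geometrically in [p]
    ([hermite_factorial_le]). *)

Set Implicit Arguments.
Unset Strict Implicit.
Unset Printing Implicit Defensive.

Import Order.TTheory GRing.Theory Num.Theory.
Local Open Scope ring_scope.

(** * Linear functionals and morphisms on monoid semirings *)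

Lemma mem_ms_supp (S : comNzSemiRingType) (K : nmodType)
    (f : monoidSemiring S K) k : (k \in ms_supp f) = (ms_coef f k != 0).
Proof. exact: mem_finsupp. Qed.

Section Linear.
Variables (S : comNzSemiRingType) (K V : nmodType) (w : S -> K -> V).

(** The weight [w c k] need only be additive in the coefficient [c], so that
    moments, evaluations and changes of exponents are all instances. *)
Definition ms_lin (f : monoidSemiring S K) : V :=
  \sum_(k <- ms_supp f) w (ms_coef f k) k.

Hypothesis w0 : forall k, w 0 k = 0.
Hypothesis wD : forall c d k, w (c + d) k = w c k + w d k.

Lemma ms_lin_fset (A : {fset K}) f :
  (ms_supp f `<=` A)%fset -> ms_lin f = \sum_(k <- A) w (ms_coef f k) k.
Proof.
move=> fA; rewrite /ms_lin (big_fset_incl _ fA) // => k _ /ms_coef_out ->.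
exact: w0.
Qed.

Lemma ms_lin0 : ms_lin 0 = 0.
Proof. by rewrite /ms_lin big1 // => k _; rewrite ms_coef0 w0. Qed.

Lemma ms_linD f g : ms_lin (f + g) = ms_lin f + ms_lin g.
Proof.
pose A := (ms_supp f `|` ms_supp g `|` ms_supp (f + g)%R)%fset.
rewrite !(@ms_lin_fset A) /A ?fsubsetUr //.
- by rewrite -big_split; apply: eq_bigr => k _; rewrite ms_coefD wD.
- by rewrite fsetUAC fsubsetUr.
- by rewrite -fsetUA fsubsetUl.
Qed.

Lemma ms_lin_monom c k : ms_lin (ms_monom c k) = w c k.
Proof.
rewrite (@ms_lin_fset [fset k]%fset) ?big_seq_fset1 ?ms_coef_monom ?eqxx //.
apply/fsubsetP => j; rewrite inE mem_ms_supp ms_coef_monom.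
by case: (j == k) => //; rewrite eqxx.
Qed.

End Linear.

Lemma ms_monomM (S : comNzSemiRingType) (K : nmodType) (c d : S) (k l : K) :
  ms_monom c k * ms_monom d l = ms_monom (c * d) (k + l).
Proof. exact: ms_mul_monom. Qed.

Lemma ms_neq0P (S : comNzSemiRingType) (K : nmodType) (f : monoidSemiring S K) :
  reflect (exists k, ms_coef f k != 0) (f != 0).
Proof.
apply: (iffP idP) => [f0|[k]]; last by apply: contra_neq => ->; rewrite ms_coef0.
have /fset0Pn[k kf] : ms_supp f != fset0.
  apply: contra_neq f0 => f0; apply: ms_ext => k.
  by rewrite ms_coef0 ms_coef_out // f0 inE.
by exists k; rewrite -mem_ms_supp.
Qed.

Section Eval.
Variables (S : comNzSemiRingType) (K : nmodType) (A : comNzSemiRingType).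
Variables (iota : {rmorphism S -> A}) (chi : K -> A).
Hypothesis chi0 : chi 0 = 1.
Hypothesis chiD : {morph chi : k l / k + l >-> k * l}.

Definition ms_eval : monoidSemiring S K -> A :=
  ms_lin (fun c k => iota c * chi k).

Let w0 k : iota 0 * chi k = 0. Proof. by rewrite rmorph0 mul0r. Qed.
Let wD c d k : iota (c + d) * chi k = iota c * chi k + iota d * chi k.
Proof. by rewrite rmorphD mulrDl. Qed.

Lemma ms_eval_monom c k : ms_eval (ms_monom c k) = iota c * chi k.
Proof. exact: ms_lin_monom. Qed.

Lemma ms_eval_nmod : nmod_morphism ms_eval.
Proof. by split=> [|f g]; [apply: ms_lin0 | apply: ms_linD]. Qed.

(** Additivity reduces the product rule to two monomials, where it is the
    exponential law [chiD]. *)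
Lemma ms_eval_monoid : monoid_morphism ms_eval.
Proof.
have [e0 eD] := ms_eval_nmod.
split=> [|f g]; first by rewrite [1]/(ms_one S K) ms_eval_monom chi0 rmorph1 mulr1.
elim/ms_ind: f => [|f f' IHf IHf'|c k]; rewrite ?(mul0r, mulrDl, eD, e0) //.
  by rewrite IHf IHf'.
elim/ms_ind: g => [|g g' IHg IHg'|d l]; rewrite ?(mulr0, mulrDr, eD, e0) //.
  by rewrite IHg IHg'.
by rewrite ms_monomM !ms_eval_monom rmorphM chiD mulrACA.
Qed.

End Eval.

Section Push.
Variables (S : comNzSemiRingType) (K L : nmodType) (h : {additive K -> L}).

Definition ms_const (c : S) : monoidSemiring S L := ms_monom c 0.

Fact ms_const_nmod : nmod_morphism ms_const.
Proof. by split=> [|c d]; [apply: ms_monom0 | apply: ms_monomD]. Qed.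
Fact ms_const_monoid : monoid_morphism ms_const.
Proof. by split=> // c d; rewrite /ms_const ms_monomM addr0. Qed.
HB.instance Definition _ :=
  GRing.isNmodMorphism.Build S (monoidSemiring S L) ms_const ms_const_nmod.
HB.instance Definition _ :=
  GRing.isMonoidMorphism.Build S (monoidSemiring S L) ms_const ms_const_monoid.

(** Substitution of [x^(h k)] for [x^k]; [h] need not be injective, so
    coefficients may add up and cancel. *)
Definition ms_push : monoidSemiring S K -> monoidSemiring S L :=
  ms_eval ms_const (fun k => ms_monom 1 (h k)).

Lemma ms_push_monom c k : ms_push (ms_monom c k) = ms_monom c (h k).
Proof. by rewrite /ms_push ms_eval_monom ms_monomM mulr1 add0r. Qed.

Fact ms_push_nmod : nmod_morphism ms_push.
Proof. exact: ms_eval_nmod. Qed.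
Fact ms_push_monoid : monoid_morphism ms_push.
Proof.
apply: ms_eval_monoid => [|k l]; first by rewrite raddf0.
by rewrite ms_monomM mulr1 raddfD.
Qed.
HB.instance Definition _ := GRing.isNmodMorphism.Build
  (monoidSemiring S K) (monoidSemiring S L) ms_push ms_push_nmod.
HB.instance Definition _ := GRing.isMonoidMorphism.Build
  (monoidSemiring S K) (monoidSemiring S L) ms_push ms_push_monoid.

End Push.
Arguments ms_push {S K L} h.

Section Domain.
Variables (S : idomainType) (K : zmodType) (lt : rel K).
Hypothesis lt_irr : irreflexive lt.
Hypothesis lt_trans : transitive lt.
Hypothesis lt_total : forall x y, x != y -> lt x y || lt y x.
Hypothesis lt_addl : forall x y z, lt x y -> lt (z + x) (z + y).

(** The order is a bare relation because the one used below on the complex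
    numbers is not one that they carry canonically. *)
Lemma fset_has_max (A : {fset K}) :
  A != fset0 -> exists2 m, m \in A & forall k, k \in A -> k != m -> lt k m.
Proof.
suff H (s : seq K) : s != [::] ->
    exists2 m, m \in s & forall k, k \in s -> k != m -> lt k m.
  move=> A0; case: (H (enum_fset A)) => [|m mA hm]; last by exists m.
  by apply: contra_neq A0 => A0; apply/fsetP => k; rewrite -[LHS]/(k \in enum_fset A) A0.
elim: s => // x [|y s] IH _.
  by exists x; rewrite ?mem_head // => k; rewrite inE => /eqP -> /eqP.
have [//|m ms hm] := IH.
have [->|xm] := eqVneq x m.
  exists m; first exact: mem_head.
  by move=> k; rewrite inE => /orP[/eqP -> /eqP//|]; apply: hm.
have /orP[lxm|lmx] := lt_total xm.
  exists m; first by rewrite inE ms orbT.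
  by move=> k; rewrite inE => /orP[/eqP -> //|]; apply: hm.
exists x; first exact: mem_head.
move=> k; rewrite inE => /orP[/eqP -> /eqP//|ks] _.
by have [->//|km] := eqVneq k m; apply: lt_trans lmx; apply: hm.
Qed.

(** The leading terms multiply: the largest exponent of [f] plus the largest
    exponent of [g] is reached by no other pair of exponents, so its
    coefficient in the product is the product of two nonzero coefficients. *)
Lemma ms_mul_neq0 (f g : monoidSemiring S K) : f != 0 -> g != 0 -> f * g != 0.
Proof.
have H (u : monoidSemiring S K) : u != 0 -> exists2 m, ms_coef u m != 0 &
    forall k, k \in ms_supp u -> k != m -> lt k m.
  case/ms_neq0P=> k; rewrite -mem_ms_supp => uk.
  have [|m mu hm] := @fset_has_max (ms_supp u).
    by apply: contraTneq uk => u0; rewrite -/(ms_supp u) u0 inE.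
  by exists m => //; rewrite -mem_ms_supp.
case/H=> m fm hm /H[n gn hn]; apply/ms_neq0P; exists (m + n).
have mf : m \in ms_supp f by rewrite mem_ms_supp.
have ng : n \in ms_supp g by rewrite mem_ms_supp.
rewrite [f * g]/(ms_mul f g) ms_coef_sum (big_fsetD1 m) //= !ms_coef_sum.
rewrite (big_fsetD1 n) //= ms_coef_monom eqxx.
rewrite !big1_fset ?addr0 ?mulf_neq0 //.
  move=> i; rewrite !inE => /andP[im iF] _; rewrite ms_coef_sum big1_fset //.
  move=> j jg _; rewrite ms_coef_monom; case: eqP => // e.
  have : lt (i + j) (m + n).
    have im' : lt (i + j) (m + j) by rewrite ![_ + j]addrC; apply/lt_addl/hm.
    have [jn|jn] := eqVneq j n; first by rewrite -[X in lt _ (_ + X)]jn.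
    by apply: lt_trans im' _; apply/lt_addl/hn.
  by rewrite e lt_irr.
move=> j; rewrite !inE => /andP[jn _] _; rewrite ms_coef_monom.
by rewrite (inj_eq (addrI m)) eq_sym (negPf jn).
Qed.

Lemma ms_prod_neq0 I (r : seq I) (P : pred I) (F : I -> monoidSemiring S K) :
  (forall i, P i -> F i != 0) -> \prod_(i <- r | P i) F i != 0.
Proof.
by move=> F0; apply: (big_ind (fun u => u != 0)) => //;
  [apply: oner_neq0 | apply: ms_mul_neq0].
Qed.

End Domain.

(** Multiplying [f] by its reflection [x^k -> x^(-k)] pairs every exponent
    with itself in degree zero.  Over the integers this forces a nonzero
    constant term if [f] is nonzero, which is what the arithmetic at the end needs. *)
Lemma ms_coef0_mul_push_opp (S : comNzRingType) (K : zmodType) (f : monoidSemiring S K) :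
  ms_coef (f * ms_push -%R f) 0 = \sum_(k <- ms_supp f) ms_coef f k ^+ 2.
Proof.
rewrite [X in X * _]ms_expand [X in _ * ms_push _ X]ms_expand raddf_sum.
rewrite mulr_suml ms_coef_sum; apply: eq_big_seq => k kf.
rewrite mulr_sumr ms_coef_sum (big_fsetD1 k) //= big1_fset => [|l].
  by rewrite addr0 ms_push_monom ms_monomM ms_coef_monom subrr eqxx.
rewrite !inE => /andP[lk _] _.
rewrite ms_push_monom ms_monomM ms_coef_monom eq_sym subr_eq0 eq_sym.
by rewrite (negPf lk).
Qed.

Section Moments.
Implicit Types A B : comNzRingType.

(** With [x^g] read as the series [exp (g z)], the element [f] becomes the
    series whose [n]-th coefficient is [moment n f / n!].  The moments make
    sense over any ring, in particular for polynomial exponents, where no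
    exponential exists. *)
Definition moment A n : monoidSemiring int A -> A :=
  ms_lin (fun c g => c%:~R * g ^+ n).

Lemma moment_nmod A n : nmod_morphism (@moment A n).
Proof.
by split=> [|f g]; [apply: ms_lin0 => k | apply: ms_linD => [k|c d k]];
  rewrite ?mul0r ?intrD ?mulrDl.
Qed.
HB.instance Definition _ A n := GRing.isNmodMorphism.Build
  (monoidSemiring int A) A (@moment A n) (@moment_nmod A n).

Lemma moment_monom A n c (g : A) : moment n (ms_monom c g) = c%:~R * g ^+ n.
Proof.
by apply: ms_lin_monom => [k]; rewrite mul0r.
Qed.

(** Leibniz rule: the exponential generating series of moments is
    multiplicative. *)
Lemma momentM A n (f g : monoidSemiring int A) :
  moment n (f * g) =
    \sum_(i < n.+1) (moment (n - i) f * moment i g) *+ 'C(n, i).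
Proof.
elim/ms_ind: f => [|f f' IHf IHf'|c k].
- by rewrite mul0r raddf0 big1 // => i _; rewrite raddf0 mul0r mul0rn.
- rewrite mulrDl raddfD /= IHf IHf' -big_split; apply: eq_bigr => i _ /=.
  by rewrite raddfD mulrDl mulrnDl.
elim/ms_ind: g => [|g g' IHg IHg'|d l].
- by rewrite mulr0 raddf0 big1 // => i _; rewrite raddf0 mulr0 mul0rn.
- rewrite mulrDr raddfD /= IHg IHg' -big_split; apply: eq_bigr => i _ /=.
  by rewrite raddfD mulrDr mulrnDl.
rewrite ms_monomM moment_monom exprDn mulr_sumr; apply: eq_bigr => i _.
by rewrite !moment_monom mulrnAr intrM mulrACA.
Qed.

Lemma moment_push A B n (h : {rmorphism A -> B}) (f : monoidSemiring int A) :
  moment n (ms_push h f) = h (moment n f).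
Proof.
elim/ms_ind: f => [|f f' IHf IHf'|c k]; rewrite ?raddf0 //.
  by rewrite !raddfD /= IHf IHf'.
by rewrite ms_push_monom !moment_monom rmorphM rmorphXn rmorph_int.
Qed.

Lemma moment_push_scale A n (a : A) (f : monoidSemiring int A) :
  moment n (ms_push (a \*o idfun) f) = a ^+ n * moment n f.
Proof.
elim/ms_ind: f => [|f f' IHf IHf'|c k]; rewrite ?raddf0 ?mulr0 //.
  by rewrite !raddfD /= IHf IHf' mulrDr.
by rewrite ms_push_monom !moment_monom exprMn mulrCA.
Qed.

End Moments.

(** * Symmetric functions of conjugates *)

Section IntValued.
Variable A : comNzRingType.

Definition int_valued (x : A) := exists z : int, x = z%:~R.

Lemma int_valued_int z : int_valued z%:~R. Proof. by exists z. Qed.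

Lemma int_valuedD x y : int_valued x -> int_valued y -> int_valued (x + y).
Proof. by move=> [a ->] [b ->]; exists (a + b); rewrite intrD. Qed.

Lemma int_valuedM x y : int_valued x -> int_valued y -> int_valued (x * y).
Proof. by move=> [a ->] [b ->]; exists (a * b); rewrite intrM. Qed.

Lemma int_valuedX x n : int_valued x -> int_valued (x ^+ n).
Proof. by move=> [a ->]; exists (a ^+ n); rewrite rmorphXn. Qed.

Lemma int_valued_sum I (r : seq I) (P : pred I) F :
  (forall i, P i -> int_valued (F i)) -> int_valued (\sum_(i <- r | P i) F i).
Proof.
by move=> h; apply: big_ind => //; [exists 0 | apply: int_valuedD].
Qed.

Lemma int_valued_prod I (r : seq I) (P : pred I) F :
  (forall i, P i -> int_valued (F i)) -> int_valued (\prod_(i <- r | P i) F i).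
Proof.
by move=> h; apply: big_ind => //; [exists 1 | apply: int_valuedM].
Qed.

End IntValued.

Section Symmetric.
Import mpoly.

(** A symmetric polynomial is an integer polynomial in the elementary symmetric
    ones, and the latter take, at the [r i], the values of the coefficients of
    [\prod_i ('X - r i)] up to sign. *)
Lemma symmetric_int_valued (A : idomainType) N (r : 'I_N -> A) (p : {mpoly int[N]}) :
  (forall k, int_valued ((\prod_i ('X - (r i)%:P))`_k)) ->
  p \is symmetric -> int_valued (mmap intr r p).
Proof.
move=> hr /sym_fundamental[t [<- _]].
rewrite comp_mpolyEX raddf_sum; apply: int_valued_sum => m _.
rewrite /= mmapZ; apply: int_valuedM; first exact: int_valued_int.
rewrite comp_mpolyX rmorph_prod; apply: int_valued_prod => i _.
rewrite rmorphXn; apply: int_valuedX; rewrite tnth_mktuple /=.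
have -> : mmap intr r (mesym N int i.+1) = (mesym N A i.+1).@[tnth [tuple r j | j < N]].
  rewrite /mesym !rmorph_sum; apply: eq_bigr => h _ /=.
  rewrite !rmorph_prod; apply: eq_bigr => j _.
  by rewrite /= mmapX mmap1U mevalXU tnth_mktuple.
have iN : (i.+1 < N.+1)%N by rewrite ltnS.
have := mroots_coeff [tuple r j | j < N] (Ordinal iN); rewrite /= => e.
suff -> : (mesym N A i.+1).@[tnth [tuple r j | j < N]] =
    (-1)^+i.+1 * (\prod_i ('X - (r i)%:P))`_(N - i.+1).
  apply: int_valuedM; last exact: hr.
  by apply: int_valuedX; exists (-1); rewrite rmorphN1.
have E : \prod_(c <- [tuple r j | j < N]) ('X - c%:P) = \prod_i ('X - (r i)%:P).
  by rewrite big_tuple; apply: eq_bigr => j _; rewrite tnth_mktuple.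
by rewrite -E e mulrA -expr2 sqrr_sign mul1r.
Qed.

Section ConjProd.
Variables (N : nat) (b : 'I_N -> int).

(** The product of all conjugates of [\sum_i b_i x^(r_i)], where every
    permutation of the [r i] is admitted in place of the Galois group: the
    product is still invariant, and no group has to be computed. *)
Definition conj_prod (V : nmodType) (r : 'I_N -> V) : monoidSemiring int V :=
  \prod_(s : 'S_N) \sum_i ms_monom (b i) (r (s i)).

(** The reflected factor makes the constant term nonzero. *)
Definition conj_square (V : zmodType) (r : 'I_N -> V) : monoidSemiring int V :=
  conj_prod r * ms_push -%R (conj_prod r).

Lemma push_conj_prod (V W : nmodType) (h : {additive V -> W}) r :
  ms_push h (conj_prod r) = conj_prod (h \o r).
Proof.
rewrite rmorph_prod; apply: eq_bigr => s _.
by rewrite raddf_sum; apply: eq_bigr => i _; rewrite /= ms_push_monom.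
Qed.

Lemma push_conj_square (V W : zmodType) (h : {additive V -> W}) r :
  ms_push h (conj_square r) = conj_square (h \o r).
Proof.
rewrite /conj_square rmorphM /= !push_conj_prod.
have -> // : h \o (-%R \o r) = -%R \o (h \o r).
by apply/funext => i /=; rewrite raddfN.
Qed.

Lemma conj_prod_perm (V : nmodType) (r : 'I_N -> V) (t : 'S_N) :
  conj_prod (r \o t) = conj_prod r.
Proof.
rewrite /conj_prod [RHS](reindex_inj (mulIg t)) /=.
by apply: eq_bigr => s _; apply: eq_bigr => i _; rewrite permM.
Qed.

(** Replacing the exponents [r i] by indeterminates, the moments become
    symmetric polynomials with integer coefficients; evaluating the
    indeterminates back at [r i] commutes with taking moments. *)
Lemma moment_conj_square_int (A : idomainType) (r : 'I_N -> A) n :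
  (forall k, int_valued ((\prod_i ('X - (r i)%:P))`_k)) ->
  int_valued (moment n (conj_square r)).
Proof.
move=> hr; pose X i : {mpoly int[N]} := 'X_i.
have -> : conj_square r = ms_push (mmap intr r) (conj_square X).
  rewrite push_conj_square; congr conj_square; apply/funext => i /=.
  by rewrite mmapX mmap1U.
rewrite moment_push; apply: symmetric_int_valued => //.
apply/issymP => s; rewrite -moment_push push_conj_square.
have -> : msym s \o X = X \o s.
  by apply/funext => i /=; rewrite /msym mmapX mmap1U.
by rewrite /conj_square conj_prod_perm.
Qed.

End ConjProd.

End Symmetric.

(** * Conjugates of algebraic numbers *)

(** In characteristic zero [p / gcd (p, p')] keeps every root of [p]: if [x] is
    a root of multiplicity [m + 1] and the quotient did not vanish at [x], the
    gcd would contain the full power [(X - x)^(m + 1)], which does not divide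
    [p']. *)
Lemma root_divp_gcdp_deriv (F : numFieldType) (p : {poly F}) x :
  p != 0 -> root p x -> root (p %/ gcdp p p^`()) x.
Proof.
move=> p0 px; set g := gcdp p p^`().
have epg : p %/ g * g = p by rewrite divpK // dvdp_gcdl.
apply/contraT => qx; exfalso.
have [m [q' hq' ep]] := multiplicity_XsubC p x; rewrite p0 /= in hq'.
case: m ep => [|m] ep; first by rewrite ep expr0 mulr1 (negPf hq') in px.
have dg : ('X - x%:P) ^+ m.+1 %| g.
  rewrite -(@Gauss_dvdpr _ _ (p %/ g)) ?epg; first by rewrite ep dvdp_mull.
  by rewrite coprimep_expl // coprimep_sym coprimep_XsubC.
have : ('X - x%:P) ^+ m.+1 %| p^`().
  by apply: dvdp_trans dg _; rewrite dvdp_gcdr.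
rewrite ep derivM dvdp_addr; last by rewrite dvdp_mull.
rewrite deriv_exp derivXsubC mul1r -mulr_natl mulrCA /= exprS.
rewrite -polyC_natr mul_polyC dvdpZr ?pnatr_eq0 //.
rewrite dvdp_mul2r ?expf_neq0 ?polyXsubC_eq0 //.
by rewrite dvdp_XsubCl (negPf hq').
Qed.

(** Both sides are multiplied by powers of [l] so that the formula holds for
    every [j] without subtraction in exponents. *)
Lemma coef_prod_XsubC_scale (A : comNzRingType) (rs : seq A) (l : A) j :
  l ^+ j * (\prod_(z <- rs) ('X - (l * z)%:P))`_j =
  l ^+ size rs * (\prod_(z <- rs) ('X - z%:P))`_j.
Proof.
elim: rs j => [|z rs IH] j.
  by rewrite !big_nil expr0 mul1r !coef1; case: j => [|j]; rewrite ?mul1r ?mulr0.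
rewrite !big_cons !mulrBl !coefB !coefXM !coefCM !mulrBr.
congr (_ - _); last by rewrite mulrCA IH /= exprS; ring.
case: j => [|j] /=; first by rewrite !mulr0.
by rewrite exprS -mulrA IH exprS mulrA.
Qed.

Section Algebraic.
Variable C : numClosedFieldType.
Implicit Types (x : C) (s : seq C).

Local Notation algebraic := (algebraicOver (ratr : rat -> C)).

Lemma algebraic_int_root x : algebraic x ->
  exists2 q : {poly int}, q != 0 & root (map_poly intr q) x.
Proof.
case=> p p0 px; have [q [a a0 ep]] := rat_poly_scale p; exists q.
  by apply: contra_neq p0 => q0; rewrite ep q0 map_poly0 scaler0.
move: px; rewrite ep linearZ /= -map_poly_comp rootZ; last first.
  by rewrite fmorph_eq0 invr_eq0 intr_eq0.
by rewrite (eq_map_poly (g := intr)) // => z /=; rewrite ratr_int.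
Qed.

Lemma algebraic_int_roots s : (forall x, x \in s -> algebraic x) ->
  exists2 q : {poly int}, q != 0 & forall x, x \in s -> root (map_poly intr q) x.
Proof.
elim: s => [_|x s IH hs]; first by exists 1; rewrite ?oner_neq0.
have [|q q0 hq] := IH; first by move=> y ys; apply: hs; rewrite inE ys orbT.
have [p p0 px] := algebraic_int_root (hs x (mem_head _ _)).
exists (p * q); first by rewrite mulf_neq0.
move=> y; rewrite inE rmorphM rootM => /orP[/eqP->|/hq ->]; last by rewrite orbT.
by rewrite px.
Qed.

(** Dividing out the powers of [X] removes the root [0] and no other. *)
Lemma algebraic_int_roots_coef0 s : (forall x, x \in s -> algebraic x) ->
  exists2 q : {poly int}, q`_0 != 0 &
    forall x, x \in s -> x != 0 -> root (map_poly intr q) x.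
Proof.
case/algebraic_int_roots=> q q0 hq.
have [m [p hp eq]] := multiplicity_XsubC q 0; rewrite q0 /= in hp.
exists p; first by rewrite -horner_coef0.
move=> x /hq; rewrite eq rmorphM rootM => /orP[//|].
rewrite subr0 rmorphXn /= map_polyX => + x0.
by rewrite rootE hornerXn expf_eq0 (negPf x0) andbF.
Qed.

(** A finite family of algebraic numbers lies among the distinct roots of one
    separable integer polynomial [q].  With [l] its leading coefficient, the
    numbers [l z] are the roots of a monic integer polynomial. *)
Lemma algebraic_conjugates s : (forall x, x \in s -> algebraic x) ->
  exists rs (l : int), [/\ uniq rs, {subset s <= rs},
    forall z, z \in rs -> algebraic z, l != 0 &
    forall k, int_valued (\prod_(z <- rs) ('X - (l%:~R * z)%:P))`_k].
Proof.
(* [p] is the separable part of a rational polynomial killing [s], and [q] an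
   integer multiple of it. *)
case/algebraic_int_roots=> q0 q00 hq0.
pose p0 : {poly rat} := map_poly intr q0.
have p00 : p0 != 0 by rewrite map_poly_eq0_id0 // intr_eq0 lead_coef_eq0.
pose p := p0 %/ gcdp p0 p0^`().
have sp : separable_poly p by apply: make_separable.
have [q [a a0 ep]] := rat_poly_scale p.
pose qC : {poly C} := map_poly intr q.
have eqC : map_poly ratr p = (ratr a%:~R^-1) *: qC.
  rewrite ep linearZ /= -map_poly_comp; congr (_ *: _).
  by apply: eq_map_poly => z /=; rewrite ratr_int.
have aC0 : ratr a%:~R^-1 != 0 :> C by rewrite fmorph_eq0 invr_eq0 intr_eq0.
have [rs ers] := closed_field_poly_normal qC.
have pne0 : p != 0 by apply: separable_poly_neq0.
have qC0 : qC != 0.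
  apply: contra_neq pne0 => e; move: eqC; rewrite e scaler0 => /eqP.
  by rewrite map_poly_eq0 => /eqP.
have lq : lead_coef qC = (lead_coef q)%:~R.
  rewrite /qC lead_coef_map_inj //; exact: intr_inj.
have l0 : lead_coef q != 0.
  by rewrite -(intr_eq0 C) -lq lead_coef_eq0.
exists rs, (lead_coef q); split => //.
- rewrite -separable_prod_XsubC.
  have : separable_poly (map_poly (ratr : rat -> C) p) by rewrite separable_map.
  rewrite eqC ers scalerA (eqp_separable (eqp_scale _ _)) //.
  by rewrite mulf_neq0 // lead_coef_eq0.
- move=> x /hq0 qx.
  have : root (map_poly (ratr : rat -> C) p) x.
    rewrite /p map_divp gcdp_map -deriv_map; apply: root_divp_gcdp_deriv.
      by rewrite map_poly_eq0.
    rewrite /p0 -map_poly_comp (eq_map_poly (g := intr)) // => z /=.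
    by rewrite ratr_int.
  rewrite eqC rootZ // ers rootZ ?lead_coef_eq0 //.
  by rewrite root_prod_XsubC.
- move=> z zrs; exists p => //.
  by rewrite eqC rootZ // ers rootZ ?lead_coef_eq0 // root_prod_XsubC.
move=> j; set l := lead_coef q in lq l0 *; set P := \prod_(_ <- _) _.
have sP : size P = (size rs).+1.
  by rewrite size_prod_XsubC.
have lC0 : l%:~R != 0 :> C by rewrite intr_eq0.
have := coef_prod_XsubC_scale rs (l%:~R : C) j; rewrite -/P => e.
have [jn|jn|->] := ltngtP j (size rs).
- exists (l ^+ (size rs - j).-1 * q`_j).
  apply: (mulfI (expf_neq0 j lC0)); rewrite e intrM rmorphXn.
  (* By the scaling formula the coefficient is [l^(N - j - 1) q_j]. *)
  have -> : (q`_j)%:~R = l%:~R * (\prod_(z <- rs) ('X - z%:P))`_j :> C.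
    by rewrite -lq -coefZ -ers coef_map.
  by rewrite !mulrA -exprD -exprSr addnC -addSn prednK ?subn_gt0 // subnK // ltnW.
- by exists 0; rewrite nth_default // sP.
exists 1.
have : P \is monic by apply: monic_prod_XsubC.
by move/monicP; rewrite /lead_coef sP.
Qed.

End Algebraic.

(** * Nonvanishing of the product of conjugates *)

Section Lex.
Variable R : rcfType.

(** Any translation invariant total order on the complex numbers would do; it
    serves to pick leading terms. *)
Definition complex_lex : rel R[i] := fun x y =>
  (complex.Re x < complex.Re y) ||
  (complex.Re x == complex.Re y) && (complex.Im x < complex.Im y).

Lemma complex_lex_irr : irreflexive complex_lex.
Proof. by move=> x; rewrite /complex_lex !ltxx andbF. Qed.

Lemma complex_lex_trans : transitive complex_lex.
Proof.
move=> [c d] [a b] [e f] /orP[/= h1|/= /andP[/eqP -> h1]] /orP[/= h2|/= /andP[/eqP <- h2]];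
  rewrite /complex_lex /=.
- by rewrite (lt_trans h1 h2).
- by rewrite h1.
- by rewrite h2.
- by rewrite eqxx (lt_trans h1 h2) orbT.
Qed.

Lemma complex_lex_total x y : x != y -> complex_lex x y || complex_lex y x.
Proof.
case: x y => [a b] [c d]; rewrite eq_complex /complex_lex /=.
by case: ltgtP => //= _; case: ltgtP.
Qed.

Lemma complex_lex_addl x y z : complex_lex x y -> complex_lex (z + x) (z + y).
Proof.
case: x y z => [a b] [c d] [e f]; rewrite /complex_lex /=.
by rewrite !ltrD2l (inj_eq (addrI e)).
Qed.

(** No conjugate factor vanishes, because the [r i] are distinct and so are
    their permutations. *)
Lemma conj_prod_neq0 N (b : 'I_N -> int) (r : 'I_N -> R[i]) :
  injective r -> (exists i, b i != 0) -> conj_prod b r != 0.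
Proof.
move=> rI [i bi].
apply: (ms_prod_neq0 complex_lex_irr complex_lex_trans complex_lex_total
  complex_lex_addl) => s _.
apply/ms_neq0P; exists (r (s i)); rewrite ms_coef_sum (bigD1 i) //= ms_coef_monom eqxx.
rewrite big1 ?addr0 // => j ji; rewrite ms_coef_monom.
by rewrite (inj_eq rI) (inj_eq perm_inj) eq_sym (negPf ji).
Qed.

Lemma conj_square_coef0 N (b : 'I_N -> int) (r : 'I_N -> R[i]) :
  injective r -> (exists i, b i != 0) -> ms_coef (conj_square b r) 0 != 0.
Proof.
move=> rI hb; rewrite /conj_square ms_coef0_mul_push_opp.
have /ms_neq0P[k fk] := conj_prod_neq0 rI hb.
set f := conj_prod b r in fk *.
have kf : k \in ms_supp f by rewrite mem_ms_supp.
rewrite (big_fsetD1 k) //= gt_eqF // ltr_wpDr ?sumr_ge0 // => [i _|].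
  exact: sqr_ge0.
by rewrite exprn_even_gt0.
Qed.

End Lex.

(** * Truncated exponential sums *)

Section ExpTail.
Import topology normedtype numFieldNormedType.Exports.

Lemma series_exp_le_expR (R : realType) (x : R) n :
  0 <= x -> series (exp_coeff x) n <= expR x.
Proof.
move=> x0; apply: nondecreasing_cvgn_le; last exact: is_cvg_series_exp_coeff.
apply/nondecreasing_seqP => m.
by rewrite !seriesEord /= big_ord_recr /= lerDl exp_coeff_ge0.
Qed.

(** Termwise, [(n + i)! >= n! i!], so the tail of the series from [n] on is
    bounded by [|x|^n / n!] times the whole series at [|x|]. *)
Lemma expR_tail_le (R : realType) (x : R) n :
  `|series (exp_coeff x) n - expR x| <= `|x| ^+ n / n`!%:R * expR `|x|.
Proof.
set B := _ * expR _.
have H m : `|series (exp_coeff x) (n + m)%N - series (exp_coeff x) n| <= B.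
  rewrite !seriesEord /= -(big_mkord xpredT) -[X in _ - X](big_mkord xpredT).
  rewrite (big_cat_nat (leq0n n) (leq_addr m n)) /= addrAC subrr add0r.
  rewrite -[X in \sum_(X <= _ < _) _]add0n big_addn addKn big_mkord.
  apply: le_trans (ler_norm_sum _ _ _) _.
  apply: (@le_trans _ _ (`|x| ^+ n / n`!%:R * series (exp_coeff `|x|) m)); last first.
    by rewrite ler_wpM2l ?series_exp_le_expR ?divr_ge0 ?exprn_ge0.
  rewrite seriesEord /= mulr_sumr ler_sum // => i _.
  rewrite /exp_coeff /= normrM normrX normfV [X in _ / X]ger0_norm // exprD.
  rewrite [X in _ <= X]mulrACA [X in X / _ <= _]mulrC ler_wpM2l ?mulr_ge0 ?exprn_ge0 //.
  rewrite -invfM lef_pV2 ?posrE -?natrM ?ltr0n ?muln_gt0 ?fact_gt0 // ler_nat.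
  rewrite -(bin_fact (leq_addl i n)) addnK.
  by rewrite leq_pmull // bin_gt0 leq_addl.
have C := @is_cvg_series_exp_coeff R x.
have near_le (P : R -> bool) : (forall m, P (series (exp_coeff x) (n + m)%N)) ->
    \forall k \near filter.eventually, P (series (exp_coeff x) k).
  by move=> hP; exists n => // k /= nk; rewrite -(subnKC nk).
rewrite distrC ler_distl; apply/andP; split.
  apply: limr_ge => //; apply: (near_le (fun y => _ <= y)) => m.
  by have := H m; rewrite ler_distl => /andP[].
apply: limr_le => //; apply: (near_le (fun y => y <= _)) => m.
by have := H m; rewrite ler_distl => /andP[].
Qed.

End ExpTail.

Section ExpSum.
Variable C : numFieldType.
Implicit Types f g : monoidSemiring int C.

(** Truncation at order [k] of [\sum_g f_g exp g]. *)
Definition expsum f k : C := \sum_(n < k.+1) moment n f / n`!%:R.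

(** This expresses [\sum_g f_g exp g = 0] without an exponential of complex
    numbers: the truncated sum then equals minus its tail, which is that
    small. *)
Definition exp_vanishes f : Prop := exists A B : C,
  [/\ 0 <= A, 0 <= B & forall k, `|expsum f k| <= A * (B ^+ k / k`!%:R)].

Lemma moment_growth g : exists A B : C,
  [/\ 0 <= A, 0 <= B & forall n, `|moment n g| <= A * B ^+ n].
Proof.
exists (\sum_(k <- ms_supp g) `|(ms_coef g k)%:~R|), (\sum_(k <- ms_supp g) `|k|).
split=> [||n]; try by apply: sumr_ge0.
rewrite mulr_suml; apply: le_trans (ler_norm_sum _ _ _) _.
rewrite big_seq [leRHS]big_seq; apply: ler_sum => k kg; rewrite normrM normrX ler_wpM2l // lerXn2r ?nnegrE //.
  exact: sumr_ge0.
by rewrite (big_fsetD1 k) //= lerDl sumr_ge0.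
Qed.

(** The partial sums of a Cauchy product are the coefficients of one series
    convolved with the partial sums of the other. *)
Lemma expsumM f g k :
  expsum (f * g) k = \sum_(i < k.+1) moment i g / i`!%:R * expsum f (k - i).
Proof.
have H n : moment n (f * g) / n`!%:R =
    \sum_(i < n.+1) moment i g / i`!%:R * (moment (n - i) f / (n - i)`!%:R).
  rewrite momentM mulr_suml; apply: eq_bigr => i _.
  have le_in : (i <= n)%N by rewrite -ltnS.
  rewrite -(bin_fact le_in) !natrM -mulr_natr.
  have f0 m : m`!%:R != 0 :> C by rewrite pnatr_eq0 -lt0n fact_gt0.
  have b0 : 'C(n, i)%:R != 0 :> C by rewrite pnatr_eq0 -lt0n bin_gt0.
  by field; rewrite !f0 b0.
elim: k => [|k IH].
  by rewrite {1}/expsum big_ord1 H !big_ord1 /expsum big_ord1 /=.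
rewrite {1}/expsum big_ord_recr /= -/(expsum _ _) IH H.
rewrite [X in _ + X = _]big_ord_recr [RHS]big_ord_recr /= addrA -big_split /=; congr (_ + _).
  apply: eq_bigr => i _ /=; rewrite -mulrDr subSn -1?ltnS //.
  by rewrite [in RHS]/expsum [in RHS]big_ord_recr.
by rewrite subnn /expsum big_ord1.
Qed.

(** A product vanishes with its factor.  The smallness of the truncations of
    [f] survives the convolution with the moments of [g], which grow
    geometrically: the binomial formula turns [B] and [B'] into [B + B']. *)
Lemma exp_vanishesM f g : exp_vanishes f -> exp_vanishes (f * g).
Proof.
case=> A [B [A0 B0 hf]]; have [A' [B' [A'0 B'0 hg]]] := moment_growth g.
exists (A * A'), (B + B'); split=> [||k]; rewrite ?mulr_ge0 ?addr_ge0 //.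
rewrite expsumM exprDn mulr_suml mulr_sumr.
apply: le_trans (ler_norm_sum _ _ _) _; apply: ler_sum => i _.
have le_ik : (i <= k)%N by rewrite -ltnS.
rewrite !normrM normfV [X in _ / X]ger0_norm //.
apply: (@le_trans _ _ (A' * B' ^+ i / i`!%:R * (A * (B ^+ (k - i) / (k - i)`!%:R)))).
  by rewrite ler_pM ?hf ?ler_wpM2r ?hg ?mulr_ge0 ?invr_ge0.
rewrite -(bin_fact le_ik) !natrM -mulr_natr.
have f0 m : m`!%:R != 0 :> C by rewrite pnatr_eq0 -lt0n fact_gt0.
have b0 : 'C(k, i)%:R != 0 :> C by rewrite pnatr_eq0 -lt0n bin_gt0.
by rewrite le_eqVlt; apply/orP; left; apply/eqP; field; rewrite !f0 b0.
Qed.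

End ExpSum.

Section RealVanishing.
Variable R : realType.

Lemma norm_real_complex (x : R) : `|x%:C%C| = `|x|%:C%C.
Proof. by rewrite normc_def /= expr0n addr0 sqrtr_sqr. Qed.

(** For real exponents, the tail estimate of the real exponential shows that an
    actual relation yields the formal one.  Exponents with zero coefficient may
    be complex: the remaining conjugates sit there. *)
Lemma real_relation_vanishes N (b : 'I_N -> int) (r : 'I_N -> R[i]) :
  (forall i, b i != 0 -> r i = (complex.Re (r i))%:C%C) ->
  \sum_i (b i)%:~R * expR (complex.Re (r i)) = 0 :> R ->
  exp_vanishes (\sum_i ms_monom (b i) (r i)).
Proof.
move=> br rel; pose a i := complex.Re (r i); set f := \sum_i _.
have e k : expsum f k = (\sum_i (b i)%:~R * series (exp_coeff (a i)) k.+1)%:C%C.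
  rewrite /expsum /f rmorph_sum.
  under eq_bigr do rewrite raddf_sum mulr_suml.
  rewrite exchange_big; apply: eq_bigr => i _ /=.
  rewrite seriesEord /= mulr_sumr rmorph_sum; apply: eq_bigr => n _ /=.
  rewrite moment_monom rmorphM rmorph_int.
  have [->|/br ri] := eqVneq (b i) 0; first by rewrite !mul0r.
  by rewrite ri /exp_coeff /= rmorphM rmorphXn fmorphV rmorph_nat mulrA.
pose A := \sum_i `|(b i)%:~R| * (`|a i| * expR `|a i|).
pose B := \sum_i `|a i|.
have A0 : 0 <= A by apply: sumr_ge0 => i _; rewrite !mulr_ge0 // expR_ge0.
have B0 : 0 <= B by apply: sumr_ge0.
exists A%:C%C, B%:C%C; split=> [||k]; rewrite ?ler0c //.
rewrite e norm_real_complex -!(rmorphXn, rmorph_nat (real_complex R)) -fmorphV -!rmorphM lecR.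
rewrite -[X in `|X|]subr0 -[X in _ - X]rel -sumrB mulr_suml.
apply: le_trans (ler_norm_sum _ _ _) _; apply: ler_sum => i _.
rewrite -mulrBr normrM -!mulrA ler_wpM2l //.
apply: le_trans (expR_tail_le _ _) _.
rewrite exprS -!mulrA ler_wpM2l // [X in _ <= X]mulrC mulrA ler_wpM2r ?expR_ge0 //.
apply: ler_pM; rewrite ?exprn_ge0 ?invr_ge0 //.
  rewrite lerXn2r ?nnegrE //.
  by rewrite /B (bigD1 i) //= lerDl sumr_ge0.
by rewrite lef_pV2 ?posrE ?ltr0n ?fact_gt0 // ler_nat factS leq_pmull.
Qed.

End RealVanishing.

(** * Hermite's polynomials *)

Section PolyNorm.
Variables (C : numDomainType) (B : C).
Hypothesis B0 : 0 <= B.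
Implicit Types P Q : {poly int}.

(** Evaluating at [B >= 0] the polynomial of absolute values gives a
    submultiplicative seminorm on integer polynomials. *)
Definition abs_poly P : {poly C} := map_poly (fun z : int => `|z%:~R|) P.

Lemma coef_abs_poly P i : (abs_poly P)`_i = `|(P`_i)%:~R|.
Proof. by rewrite coef_map_id0 // normr0. Qed.

Lemma abs_poly_wide P n : (size P <= n)%N ->
  (abs_poly P).[B] = \sum_(i < n) `|(P`_i)%:~R| * B ^+ i.
Proof.
move=> Pn; rewrite (@horner_coef_wide _ n); last first.
  by rewrite (leq_trans _ Pn) // size_poly.
by apply: eq_bigr => i _; rewrite coef_abs_poly.
Qed.

Lemma abs_poly_ge0 P : 0 <= (abs_poly P).[B].
Proof.
rewrite (abs_poly_wide (leqnn _)) sumr_ge0 // => i _.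
by rewrite mulr_ge0 ?exprn_ge0.
Qed.

Lemma abs_polyD_le P Q : (abs_poly (P + Q)).[B] <= (abs_poly P).[B] + (abs_poly Q).[B].
Proof.
pose n := maxn (size P) (size Q).
rewrite !(@abs_poly_wide _ n) ?leq_maxl ?leq_maxr ?size_polyD //.
rewrite -big_split /= ler_sum // => i _.
by rewrite -mulrDl ler_wpM2r ?exprn_ge0 // coefD intrD ler_normD.
Qed.

Lemma abs_polyMXaddC P c : abs_poly (P * 'X + c%:P) = abs_poly P * 'X + `|c%:~R|%:P.
Proof.
apply/polyP => i; rewrite coef_abs_poly !coefD !coefMX !coefC coef_abs_poly.
by case: i => [|i] /=; rewrite ?add0r ?addr0.
Qed.

Lemma abs_polyM_le P Q : (abs_poly (P * Q)).[B] <= (abs_poly P).[B] * (abs_poly Q).[B].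
Proof.
elim/poly_ind: P => [|P c IH].
  by rewrite mul0r /abs_poly !map_poly0 hornerC mul0r.
rewrite mulrDl mulrAC; apply: le_trans (abs_polyD_le _ _) _.
rewrite abs_polyMXaddC hornerMXaddC mulrDl lerD //.
  have -> : abs_poly (P * Q * 'X) = abs_poly (P * Q) * 'X.
    by rewrite -[P * Q * 'X]addr0 -polyC0 abs_polyMXaddC normr0 polyC0 addr0.
  by rewrite hornerMX mulrAC ler_wpM2r.
have -> : abs_poly (c%:P * Q) = `|c%:~R|%:P * abs_poly Q.
  by apply/polyP => i; rewrite coefCM !coef_abs_poly coefCM intrM normrM.
by rewrite hornerM hornerC.
Qed.

Lemma abs_polyX_le P n : (abs_poly (P ^+ n)).[B] <= (abs_poly P).[B] ^+ n.
Proof.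
elim: n => [|n IH].
  rewrite !expr0 (@abs_poly_wide _ 1) ?size_poly1 //.
  by rewrite big_ord1 coef1 normr1 mulr1.
rewrite !exprS; apply: le_trans (abs_polyM_le _ _) _.
by rewrite ler_wpM2l ?abs_poly_ge0.
Qed.

End PolyNorm.

Lemma root_derivn (F : fieldType) (P : {poly F}) x n m :
  ('X - x%:P) ^+ n %| P -> (m < n)%N -> root P^`(m) x.
Proof.
elim: m n P => [|m IH] [//|n] P dP mn.
  by rewrite derivn0 -dvdp_XsubCl (dvdp_trans _ dP) // exprS dvdp_mulr.
rewrite derivSn; apply: (IH n) => //.
have /dvdpP[q ->] := dP.
rewrite derivM; apply: dvdp_add.
  by apply: dvdp_mull; rewrite exprS; apply: dvdp_mull.
by rewrite deriv_exp -mulr_natl; do 3!apply: dvdp_mull.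
Qed.

Section Hermite.
Variable C : numFieldType.
Variable f : monoidSemiring int C.
Implicit Types P Q T : {poly int}.

Local Notation pC P := (map_poly (intr : int -> C) P).

(** The linear functional sending [X^k] to [moment k f]. *)
Definition poly_moment P : C :=
  \sum_(g <- ms_supp f) (ms_coef f g)%:~R * (pC P).[g].

Lemma poly_momentD P Q : poly_moment (P + Q) = poly_moment P + poly_moment Q.
Proof.
rewrite -big_split; apply: eq_bigr => g _ /=.
by rewrite rmorphD hornerD mulrDr.
Qed.

Lemma poly_momentMn P n : poly_moment (P *+ n) = poly_moment P *+ n.
Proof.
rewrite -sumrMnl; apply: eq_bigr => g _.
by rewrite rmorphMn hornerMn mulrnAr.
Qed.

Lemma poly_moment0 : poly_moment 0 = 0.
Proof. by rewrite /poly_moment big1 // => g _; rewrite map_poly0 hornerC mulr0. Qed.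

Lemma poly_moment_sum I (r : seq I) (p : pred I) (F : I -> {poly int}) :
  poly_moment (\sum_(i <- r | p i) F i) = \sum_(i <- r | p i) poly_moment (F i).
Proof. exact: (big_morph poly_moment poly_momentD poly_moment0). Qed.

Lemma poly_momentZ c P : poly_moment (c *: P) = c%:~R * poly_moment P.
Proof.
rewrite mulr_sumr; apply: eq_bigr => g _.
by rewrite map_polyZ hornerZ mulrCA.
Qed.

Lemma poly_moment_coef P n : (size P <= n)%N ->
  poly_moment P = \sum_(k < n) (P`_k)%:~R * moment k f.
Proof.
move=> Pn; under eq_bigr do rewrite mulr_sumr.
rewrite exchange_big; apply: eq_bigr => g _ /=.
rewrite (@horner_coef_wide _ n); last by rewrite (leq_trans (size_poly _ _)).
by rewrite mulr_sumr; apply: eq_bigr => k _; rewrite coef_map /= mulrCA.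
Qed.

Definition derivn_sum P n := \sum_(m < n) P^`(m).

(** Hermite's identity: the derivatives of [X^k] at [g] are the numbers
    [k! g^i / i!] for [i <= k], so their sum is [k!] times a truncated
    exponential. *)
Lemma factorial_expsum k n : (k < n)%N ->
  k`!%:R * expsum f k = poly_moment (derivn_sum 'X^k n).
Proof.
move=> kn; rewrite /expsum.
under eq_bigr do rewrite mulr_suml.
rewrite exchange_big mulr_sumr; apply: eq_bigr => g _ /=.
under eq_bigr do rewrite -mulrA.
rewrite -mulr_sumr mulrCA; congr (_ * _).
rewrite /derivn_sum rmorph_sum horner_sum mulr_sumr.
rewrite -(subnKC kn) big_split_ord [X in _ = _ + X]big1 ?addr0; last first.
  move=> i _; rewrite derivnXn ffact_small ?mulr0n ?rmorph0 ?hornerC //.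
  exact: leq_addr.
(* The derivative of order [k - i] gives the term of degree [i]. *)
rewrite (reindex_inj rev_ord_inj) /=; apply: eq_bigr => i _.
rewrite subSS derivnXn rmorphMn /= map_polyXn hornerMn hornerXn -mulr_natl.
have ik : (i <= k)%N by rewrite -ltnS.
rewrite -(ffact_fact ik) natrM -[RHS]mulr_natl.
by field; rewrite pnatr_eq0 -lt0n fact_gt0.
Qed.

Lemma sum_factorial_expsum Q n : (size Q <= n)%N ->
  \sum_(k < n) (Q`_k)%:~R * (k`!%:R * expsum f k) = poly_moment (derivn_sum Q n).
Proof.
move=> Qn; have eQ : Q = \sum_(k < n) Q`_k *: 'X^k.
  rewrite -poly_def; apply/polyP => i; rewrite coef_poly.
  by case: ltnP => // ni; rewrite nth_default // (leq_trans Qn).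
have eD : derivn_sum Q n = \sum_(k < n) Q`_k *: derivn_sum 'X^k n.
  rewrite /derivn_sum {1}eQ; under eq_bigr do rewrite linear_sum.
  rewrite exchange_big; apply: eq_bigr => k _ /=.
  by rewrite scaler_sumr; apply: eq_bigr => m _; rewrite linearZ.
rewrite eD poly_moment_sum; apply: eq_bigr => k _.
by rewrite poly_momentZ (factorial_expsum (ltn_ord k)).
Qed.

Variables (T : {poly int}) (l : int) (A B : C).
Hypothesis T0 : T`_0 != 0.
Hypothesis T_root : forall g, g \in ms_supp f -> g != 0 -> root (pC T) g.
Hypothesis l0 : l != 0.
Hypothesis l_int : forall n, int_valued (l%:~R ^+ n * moment n f).
Hypothesis A0 : 0 <= A.
Hypothesis B0 : 0 <= B.
Hypothesis small : forall k, `|expsum f k| <= A * (B ^+ k / k`!%:R).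

(** The polynomial of Hermite and Lindemann.  It vanishes at least to order [p]
    at each nonzero exponent of [f], and only to order [p - 1] at zero. *)
Definition hermite p : {poly int} := 'X^(p.-1) * T ^+ p.

Lemma size_hermite p : (0 < p)%N -> (size (hermite p) <= p * size T)%N.
Proof.
move=> p0; have sT : (0 < size T)%N.
  by rewrite lt0n; apply: contraNneq T0 => sT; rewrite nth_default // sT.
apply: leq_trans (size_polyMleq _ _) _; rewrite size_polyXn.
rewrite prednK // -subn1 leq_subLR.
apply: leq_trans (leq_add (leqnn _) (size_poly_exp_leq _ _)) _.
by rewrite addnS mulnC add1n ltnS -mulnS prednK.
Qed.

(** Among the derivatives of order below [p], only the one of order [p - 1] at
    zero survives. *)
Lemma hermite_derivn_low p g : (0 < p)%N -> g \in ms_supp f ->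
  (pC (derivn_sum (hermite p) p)).[g] =
  if g == 0 then (p.-1)`!%:R * (T`_0)%:~R ^+ p else 0.
Proof.
case: p => // p _ gf; case: eqP => [->|/eqP g0].
  rewrite horner_coef0 coef_map /=.
  suff -> : (derivn_sum (hermite p.+1) p.+1)`_0 = p`!%:R * T`_0 ^+ p.+1.
    by rewrite rmorphM rmorph_nat rmorphXn.
  rewrite /derivn_sum coef_sum big_ord_recr /=.
  rewrite big1 ?add0r => [|i _].
    rewrite coef_derivn addn0 /hermite coefXnM ltnn subnn ffactnn.
    by rewrite -!horner_coef0 horner_exp -[LHS]mulr_natl.
  by rewrite coef_derivn addn0 /hermite coefXnM ltn_ord mul0rn.
rewrite /derivn_sum rmorph_sum horner_sum big1 // => i _ /=.
apply/eqP; rewrite -derivn_map; apply: (@root_derivn _ _ _ p.+1) => //.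
rewrite /hermite rmorphM !rmorphXn /= dvdp_mull // dvdp_exp2r //.
by rewrite dvdp_XsubCl T_root.
Qed.

(** The derivatives of order at least [p], divided by [p!]; this is again an
    integer polynomial since [m!] is a multiple of [p!] and [Q^(m) / m!] is
    integral. *)
Definition hermite_high Q p n : {poly int} :=
  \sum_(p <= m < n) Q^`N(m) *+ (m ^_ (m - p)).

Lemma derivn_sum_high Q p n : (p <= n)%N ->
  derivn_sum Q n = derivn_sum Q p + hermite_high Q p n *+ p`!.
Proof.
move=> pn; rewrite /derivn_sum -!(big_mkord xpredT (fun m => Q^`(m))).
rewrite (big_cat_nat (leq0n p) pn) /=; congr (_ + _).
rewrite /hermite_high -sumrMnl; apply: eq_big_nat => m /andP[pm _].
by rewrite nderivn_def -mulrnA -{2}(subKn pm) ffact_fact // leq_subr.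
Qed.

(** One power of [l] per degree clears the denominators of all moments. *)
Lemma poly_moment_int P n : (size P <= n)%N ->
  int_valued (l%:~R ^+ n * poly_moment P).
Proof.
move=> Pn; rewrite (poly_moment_coef Pn) mulr_sumr; apply: int_valued_sum => k _.
have -> : l%:~R ^+ n = l%:~R ^+ (n - k) * l%:~R ^+ k :> C.
  by rewrite -exprD subnK // ltnW.
have -> (a b c d : C) : a * b * (c * d) = a * c * (b * d) by ring.
apply: int_valuedM => //; apply: int_valuedM; last exact: int_valued_int.
by apply: int_valuedX; apply: int_valued_int.
Qed.

Lemma size_hermite_high Q p n : (size (hermite_high Q p n) <= size Q)%N.
Proof.
apply/leq_sizeP => j Qj; rewrite coef_sum big1 // => m _.
by rewrite coefMn coef_nderivn nth_default ?mul0rn // (leq_trans Qj) ?leq_addl.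
Qed.

(** Let [L] be the sum over [g] of [f_g] times all derivatives of
    [hermite p] at [g].  Arithmetically, [l^n L] is [(p - 1)!] times an integer
    congruent to [l^n f_0 T(0)^p] modulo [p], hence nonzero, so it is at least
    [(p - 1)!].  Analytically, [L] is a combination of the numbers
    [k! expsum f k], which [small] bounds by [A B^k], so it is at most
    geometric in [p]. *)
Lemma hermite_factorial_le p : ms_coef f 0 != 0 -> prime p ->
  (`|ms_coef f 0|%N < p)%N -> (`|l|%N < p)%N -> (`|(T`_0)%R|%N < p)%N ->
  (p.-1)`!%:R <= A * (`|l%:~R| ^+ size T * (1 + B) * (abs_poly C T).[B]) ^+ p.
Proof.
move=> c0 pp pc pl pT; have p0 := prime_gt0 pp.
(* [n] bounds the size of [hermite p] and is a multiple of [p], which makes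
   [|l|^n] geometric in [p]. *)
set c := ms_coef f 0 in c0 pc; set Q := hermite p; set n := (p * size T)%N.
have Qn : (size Q <= n)%N := size_hermite p0.
have T1 : (0 < size T)%N.
  by rewrite lt0n; apply: contraNneq T0 => sT; rewrite nth_default // sT.
have pn : (p <= n)%N by rewrite leq_pmulr.
have upper : `|poly_moment (derivn_sum Q n)| <= A * (abs_poly C Q).[B].
  rewrite -(sum_factorial_expsum Qn) (abs_poly_wide B Qn) mulr_sumr.
  apply: le_trans (ler_norm_sum _ _ _) _; apply: ler_sum => k _.
  rewrite !normrM [leRHS]mulrCA ler_wpM2l // [X in X * _]ger0_norm //.
  have := small k; rewrite mulrA ler_pdivlMr ?ltr0n ?fact_gt0 //.
  by rewrite mulrC.
have low : poly_moment (derivn_sum Q p) = c%:~R * ((p.-1)`!%:R * (T`_0)%:~R ^+ p).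
  have z0 : 0 \in ms_supp f by rewrite mem_ms_supp.
  rewrite /poly_moment (big_fsetD1 0) //= hermite_derivn_low // eqxx.
  rewrite big1_fset ?addr0 // => g; rewrite !inE => /andP[g0 gf] _.
  by rewrite hermite_derivn_low // (negPf g0) mulr0.
have [k hk] := poly_moment_int (leq_trans (size_hermite_high Q p n) Qn).
pose z := l ^+ n * c * T`_0 ^+ p + k *+ p.
have ez : l%:~R ^+ n * poly_moment (derivn_sum Q n) = (p.-1)`!%:R * z%:~R.
  have ep : p`!%:R = p%:R * (p.-1)`!%:R :> C.
    by rewrite -natrM -{1 2}(prednK p0) factS.
  rewrite (derivn_sum_high Q pn) poly_momentD low poly_momentMn -[_ *+ p`!]mulr_natl.
  rewrite mulrDr [X in _ + X]mulrCA hk ep /z -[k *+ p]mulr_natl.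
  rewrite intrD !intrM !rmorphXn rmorph_nat /=.
  have (L c' F t k' P : C) :
      L * (c' * (F * t)) + P * F * k' = F * (L * c' * t + P * k') by ring.
  exact.
have z0 : z != 0.
  apply/eqP => zz; have : (p %| `|(l ^+ n * c * T`_0 ^+ p)%R|)%N.
    have -> : l ^+ n * c * T`_0 ^+ p = - (k *+ p) by apply/eqP; rewrite -addr_eq0 -/z zz.
    by rewrite abszN -mulr_natr abszM natz dvdn_mull.
  have nd x : x != 0 -> (`|x|%N < p)%N -> ~~ (p %| `|x|)%N.
    by move=> x0; rewrite ltnNge; apply: contra => /dvdn_leq; apply; rewrite absz_gt0.
  rewrite !abszM !abszX !Euclid_dvdM // !Euclid_dvdX //.
  by rewrite (negPf (nd _ l0 pl)) (negPf (nd _ c0 pc)) (negPf (nd _ T0 pT)).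
have lower : (p.-1)`!%:R <= `|l%:~R ^+ n * poly_moment (derivn_sum Q n)|.
  rewrite ez normrM ger0_norm // ler_peMr // -intr_norm ler1z.
  by rewrite -gtz0_ge1 normr_gt0.
apply: le_trans lower _; rewrite normrM normrX.
apply: le_trans (ler_wpM2l (exprn_ge0 _ (normr_ge0 _)) upper) _.
rewrite mulrCA ler_wpM2l // !exprMn -exprM [(size T * p)%N]mulnC -mulrA ler_wpM2l ?exprn_ge0 //.
apply: le_trans (abs_polyM_le B0 _ _) _.
have B1 : 0 <= 1 + B by rewrite addr_ge0.
apply: ler_pM; rewrite ?abs_poly_ge0 ?abs_polyX_le //.
have -> : (abs_poly C 'X^(p.-1)).[B] = B ^+ p.-1.
  have -> : abs_poly C 'X^(p.-1) = 'X^(p.-1).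
    by apply/polyP => i; rewrite coef_abs_poly !coefXn rmorph_nat normr_nat.
  by rewrite hornerXn.
apply: (@le_trans _ _ ((1 + B) ^+ p.-1)).
  by rewrite lerXn2r ?nnegrE // lerDr.
by rewrite -[in leRHS](prednK p0) exprS ler_peMl ?exprn_ge0 // lerDl.
Qed.

End Hermite.

(** * The Lindemann-Weierstrass theorem *)

(** From [x^p / p! <= exp x] at [x = 4 (e + 1)]: one factor [2^p] absorbs the
    passage from [p!] to [(p - 1)!], and the other absorbs the constants. *)
Lemma geometric_lt_factorial (R : realType) (a e : R) : 0 <= a -> 0 <= e ->
  exists n0, forall p, (n0 < p)%N -> a * e ^+ p < (p.-1)`!%:R.
Proof.
move=> a0 e0; pose c := e + 1; pose M := expR (4 * c).
have c0 : 0 < c by rewrite ltr_wpDl.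
have M0 : 0 < M by apply: expR_gt0.
(* Beyond this bound [a M < p < 2^p]. *)
exists (Num.bound (a * M)) => p np.
have p0 : (0 < p)%N by apply: leq_trans np.
have ap : a * M < 2 ^+ p.
  apply: lt_trans (archi_boundP (mulr_ge0 a0 (ltW M0))) _.
  by rewrite -natrX ltr_nat (ltn_trans np) // ltn_expl.
have h1 : (4 * c) ^+ p <= M * p`!%:R.
  rewrite -ler_pdivrMr ?ltr0n ?fact_gt0 //.
  have := @expR_ge1Dxn R (4 * c) p.-1; rewrite prednK // => /(_ _) h.
  by apply: le_trans (h _); rewrite ?lerDr // mulr_ge0 // ltW.
have h2 : p`!%:R <= 2 ^+ p * (p.-1)`!%:R :> R.
  rewrite -natrX -natrM ler_nat -{1}(prednK p0) factS prednK // leq_mul2r.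
  by rewrite ltnW ?orbT // ltn_expl.
have h3 : 2 ^+ p * c ^+ p <= M * (p.-1)`!%:R.
  have := le_trans h1 (ler_wpM2l (ltW M0) h2).
  have -> : 4 * c = 2 * (2 * c) by ring.
  by rewrite exprMn mulrCA ler_pM2l ?exprn_gt0 // exprMn.
rewrite -(ltr_pM2l M0); apply: lt_le_trans h3.
rewrite mulrA [M * a]mulrC; apply: (@le_lt_trans _ _ (a * M * c ^+ p)).
  by rewrite ler_wpM2l ?mulr_ge0 ?(ltW M0) // lerXn2r ?nnegrE ?(ltW c0) // lerDl.
by rewrite ltr_pM2r ?exprn_gt0.
Qed.

(** For large primes [p] the factorial in [hermite_factorial_le] outgrows the
    geometric bound; both are real, although stated in the complex field. *)
Lemma hermite_contradiction (R : realType) (f : monoidSemiring int R[i]) (l : int) :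
  ms_coef f 0 != 0 ->
  (forall g, g \in ms_supp f -> algebraicOver (ratr : rat -> R[i]) g) ->
  l != 0 -> (forall n, int_valued (l%:~R ^+ n * moment n f)) ->
  ~ exp_vanishes f.
Proof.
move=> c0 falg l0 lint [A [B [A0 B0 small]]].
have [T T0 Troot] := algebraic_int_roots_coef0 falg.
have [E E0 hE] : exists2 E : R[i], 0 <= E & forall p, prime p ->
    (`|ms_coef f 0| + `|l| + `|(T`_0)%R| < p)%N -> (p.-1)`!%:R <= A * E ^+ p.
  exists (`|l%:~R| ^+ size T * (1 + B) * (abs_poly R[i] T).[B]).
    by rewrite !mulr_ge0 ?exprn_ge0 ?abs_poly_ge0 ?addr_ge0.
  have lt3 u v w p : (u + v + w < p)%N -> [/\ (u < p)%N, (v < p)%N & (w < p)%N].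
    move=> h; split; apply: leq_ltn_trans h; rewrite ?leq_addl // -addnA ?leq_addr //.
    by rewrite addnCA leq_addr.
  move=> p pp /lt3[h1 h2 h3].
  exact: (hermite_factorial_le T0 Troot l0 lint A0 B0 small c0 pp h1 h2 h3).
have real (x : R[i]) : 0 <= x -> exists a : R, x = a%:C%C.
  by move=> x0; exists (complex.Re x); rewrite RRe_real ?ger0_real.
have [a eA] := real _ A0; have [e eE] := real _ E0.
rewrite eA ler0c in A0; rewrite eE ler0c in E0.
have [n0 hn0] := geometric_lt_factorial A0 E0.
have [p lt_p pp] := prime_above (n0 + (`|ms_coef f 0| + `|l| + `|(T`_0)%R|)).
have := hn0 p (leq_ltn_trans (leq_addr _ _) lt_p).
rewrite ltNge => /negP; apply.
have := hE p pp (leq_ltn_trans (leq_addl _ _) lt_p).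
by rewrite eA eE -(rmorph_nat (real_complex R)) -rmorphXn -rmorphM lecR.
Qed.

Section Support.
Variables (S : comNzSemiRingType) (K : nmodType) (P : K -> Prop).
Implicit Types f g : monoidSemiring S K.

(** Used to see that the exponents of a product of conjugates are sums of
    algebraic numbers, hence algebraic. *)
Definition supported f := forall k, k \in ms_supp f -> P k.

Lemma supported_monom c k : P k -> supported (ms_monom c k).
Proof.
move=> Pk j; rewrite mem_ms_supp ms_coef_monom.
by have [->|] := eqVneq j k; rewrite ?eqxx.
Qed.

Lemma supportedD f g : supported f -> supported g -> supported (f + g).
Proof.
move=> hf hg k; rewrite mem_ms_supp ms_coefD.
case: (boolP (k \in ms_supp f)) => [/hf //|/ms_coef_out ->].
case: (boolP (k \in ms_supp g)) => [/hg //|/ms_coef_out ->].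
by rewrite addr0 eqxx.
Qed.

Lemma supported0 : supported 0.
Proof. by move=> k; rewrite mem_ms_supp ms_coef0 eqxx. Qed.

Hypothesis P0 : P 0.
Hypothesis PD : forall k l, P k -> P l -> P (k + l).

Lemma supported_sum I (r : seq I) (p : pred I) (F : I -> monoidSemiring S K) :
  (forall i, p i -> supported (F i)) -> supported (\sum_(i <- r | p i) F i).
Proof. by move=> h; apply: big_ind => //; [apply: supported0 | apply: supportedD]. Qed.

Lemma supportedM f g : supported f -> supported g -> supported (f * g).
Proof.
move=> hf hg; rewrite [f * g]/(ms_mul f g) /ms_mul big_seq.
apply: supported_sum => i fi; rewrite big_seq; apply: supported_sum => j gj.
by apply: supported_monom; apply: PD; [apply: hf | apply: hg].
Qed.

Lemma supported_prod I (r : seq I) (p : pred I) (F : I -> monoidSemiring S K) :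
  (forall i, p i -> supported (F i)) -> supported (\prod_(i <- r | p i) F i).
Proof.
move=> h; apply: big_ind => //; last exact: supportedM.
exact: supported_monom.
Qed.

End Support.

Lemma conj_prod_supported N (b : 'I_N -> int) (V : nmodType) (P : V -> Prop)
    (r : 'I_N -> V) :
  P 0 -> (forall u v, P u -> P v -> P (u + v)) -> (forall i, P (r i)) ->
  supported P (conj_prod b r).
Proof.
move=> P0 PD Pr; apply: supported_prod => // s _.
by apply: supported_sum => i _; apply: supported_monom.
Qed.

Lemma conj_square_supported N (b : 'I_N -> int) (V : zmodType) (P : V -> Prop)
    (r : 'I_N -> V) :
  P 0 -> (forall u v, P u -> P v -> P (u + v)) -> (forall u, P u -> P (- u)) ->
  (forall i, P (r i)) -> supported P (conj_square b r).
Proof.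
move=> P0 PD PN Pr; apply: supportedM => //; first exact: conj_prod_supported.
by rewrite push_conj_prod; apply: conj_prod_supported => // i; apply: PN.
Qed.

(** A nonzero coefficient would make [conj_square b r] an exponential sum of the
    kind excluded by [hermite_contradiction]: it vanishes together with its
    factor, the given relation. *)
Lemma lindemann_weierstrass_indexed (R : realType) N (b : 'I_N -> int)
    (r : 'I_N -> R[i]) (l : int) :
  injective r -> (forall i, algebraicOver (ratr : rat -> R[i]) (r i)) ->
  l != 0 ->
  (forall k, int_valued (\prod_i ('X - (l%:~R * r i)%:P))`_k) ->
  (forall i, b i != 0 -> r i = (complex.Re (r i))%:C%C) ->
  \sum_i (b i)%:~R * expR (complex.Re (r i)) = 0 :> R ->
  forall i, b i = 0.
Proof.
move=> rI ralg l0 lint br rel i; apply/eqP/contraT => bi.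
case: (@hermite_contradiction R (conj_square b r) l).
- by apply: conj_square_coef0 => //; exists i.
- apply: conj_square_supported => //; first exact: algebraic0.
  + exact: algebraic_add.
  + exact: algebraic_opp.
- exact: l0.
- move=> n; rewrite -moment_push_scale push_conj_square.
  exact: moment_conj_square_int.
(* The factor of the identity permutation is the given relation. *)
rewrite /conj_square /conj_prod (bigD1 1%g) //= -mulrA; apply: exp_vanishesM.
by under eq_bigr do rewrite perm1; apply: real_relation_vanishes.
Qed.

(** The exponents are embedded among all their complex conjugates, and the
    coefficients are extended by zero. *)
Theorem lindemann_weierstrass_real (R : realType) (s : seq R) (b : R -> int) :
  uniq s -> (forall x, x \in s -> algebraicOver (ratr : rat -> R) x) ->
  \sum_(x <- s) (b x)%:~R * expR x = 0 -> forall x, x \in s -> b x = 0.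
Proof.
move=> us salg rel x xs.
pose sC : seq R[i] := [seq y%:C%C | y <- s].
have sCalg z : z \in sC -> algebraicOver (ratr : rat -> R[i]) z.
  case/mapP=> y /salg[p p0 py] ->; exists p => //.
  have -> : map_poly (ratr : rat -> R[i]) p =
      map_poly (real_complex R) (map_poly ratr p).
    rewrite -map_poly_comp; apply: eq_map_poly => q /=.
    by rewrite fmorph_rat.
  by rewrite fmorph_root.
have [rs [l [urs sub rsalg l0 lint]]] := algebraic_conjugates sCalg.
(* The conjugates outside [sC] receive the coefficient zero. *)
pose c (z : R[i]) : int := if z \in sC then b (complex.Re z) else 0.
pose r i := tnth (in_tuple rs) i.
have xrs : x%:C%C \in rs by apply: sub; apply: map_f.
have ix : (index x%:C%C rs < size rs)%N by rewrite index_mem.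
have := @lindemann_weierstrass_indexed R (size rs) (c \o r) r l.
move=> /(_ _ _ l0 _ _ _ (Ordinal ix)); rewrite /= /r (tnth_nth 0) /= nth_index //.
rewrite /c map_f //; apply.
- by apply/tuple_uniqP.
- by move=> i; apply: rsalg; apply: mem_tnth.
- by move=> k; have := lint k; rewrite big_tnth.
- move=> i; case: ifP => [/mapP[y _ ->] //|_]; by rewrite eqxx.
rewrite -(big_tnth _ _ rs xpredT (fun z => (c z)%:~R * expR (complex.Re z))).
rewrite (bigID (mem sC)) /= [X in _ + X]big1 ?addr0 => [|z /negPf zs]; last first.
  by rewrite /c zs mul0r.
rewrite -big_filter (perm_big sC) /=.
  rewrite big_map -[RHS]rel; apply: eq_big_seq => y ys.
  by rewrite /c map_f.
apply: uniq_perm; rewrite ?filter_uniq //.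
  by rewrite map_inj_uniq //; apply: complexI.
move=> z; rewrite mem_filter; case: (boolP (z \in sC)) => //= /sub.
by [].
Qed.

(** * The isomorphism *)

Lemma semiring_isomorphic_sym (A B : pzSemiRingType) (g : {rmorphism A -> B}) :
  bijective g -> semiring_isomorphic B A.
Proof.
move=> bg; have [h gK hK] := bg; have gI := can_inj gK.
have hD : nmod_morphism h.
  by split=> [|x y]; apply: gI; rewrite ?raddf0 ?raddfD /= !hK.
have hM : monoid_morphism h.
  by split=> [|x y]; apply: gI; rewrite ?rmorph1 ?rmorphM /= !hK.
pose hA := GRing.isNmodMorphism.Build B A h hD.
pose hB := GRing.isMonoidMorphism.Build B A h hM.
pose hm : {rmorphism B -> A} := HB.pack h hA hB.
by exists hm; exists g.
Qed.

Section ExpEval.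
Variables (R : realType) (M : addrClosed R).

Fact exp_subproof (k : submonoid M) : expR (val k) \in in_expset M.
Proof. by rewrite inE; apply: expset_exp; apply: valP. Qed.

Definition exp_elt (k : submonoid M) : expSemiring M := ExpSemiring (exp_subproof k).

Fact exp_elt0 : exp_elt 0 = 1.
Proof. by apply: val_inj; rewrite /= expR0. Qed.

Fact exp_eltD : {morph exp_elt : k l / k + l >-> k * l}.
Proof. by move=> k l; apply: val_inj; rewrite /= expRD. Qed.

Definition exp_eval : monoidSemiring nat (submonoid M) -> expSemiring M :=
  ms_eval (GRing.natmul 1) exp_elt.

HB.instance Definition _ := GRing.isNmodMorphism.Build
  (monoidSemiring nat (submonoid M)) (expSemiring M) exp_eval
  (ms_eval_nmod _ _).
HB.instance Definition _ := GRing.isMonoidMorphism.Build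
  (monoidSemiring nat (submonoid M)) (expSemiring M) exp_eval
  (ms_eval_monoid _ exp_elt0 exp_eltD).

(** The image is an additive submonoid containing the generators. *)
Lemma exp_eval_surj x : exists f, exp_eval f = x.
Proof.
case: x => x xE; have := xE; rewrite inE.
move=> /(_ [set y | exists f, val (exp_eval f) = y]%classic) [].
  split=> [|_ [m mM <-]].
    split; first by exists 0; rewrite raddf0.
    by move=> _ _ [f <-] [g <-]; exists (f + g); rewrite raddfD.
  exists (ms_monom 1%N (Submonoid mM)).
  by rewrite /exp_eval ms_eval_monom mul1r.
by move=> f ef; exists f; apply: val_inj.
Qed.

Hypothesis Malg : forall x : R, x \in M -> algebraicOver (ratr : rat -> R) x.

(** If two polynomials have the same value, the differences of their
    coefficients are the coefficients of a relation between exponentials. *)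
Lemma exp_eval_inj : injective exp_eval.
Proof.
move=> f g efg; pose A := (ms_supp f `|` ms_supp g)%fset.
pose b (x : R) : int :=
  if insub x is Some k then (ms_coef f k)%:Z - (ms_coef g k)%:Z else 0.
have bE (k : submonoid M) : b (val k) = (ms_coef f k)%:Z - (ms_coef g k)%:Z.
  by rewrite /b valK.
have vE h : (ms_supp h `<=` A)%fset ->
    val (exp_eval h) = \sum_(k <- A) (ms_coef h k)%:R * expR (val k).
  move=> hA; rewrite /exp_eval /ms_eval (ms_lin_fset _ hA); last first.
    by move=> k; rewrite mul0r.
  rewrite raddf_sum; apply: eq_bigr => k _ /=.
  by congr (_ * _); rewrite -[LHS]/(val (ms_coef h k)%:R) rmorph_nat.
have rel : \sum_(x <- [seq val k | k <- A]) (b x)%:~R * expR x = 0.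
  rewrite big_map; under eq_bigr => k _ do rewrite bE intrB mulrBl -!pmulrn.
  rewrite sumrB -!vE ?efg ?subrr //; [exact: fsubsetUr | exact: fsubsetUl].
have b0 := lindemann_weierstrass_real _ _ rel.
apply: ms_ext => k; case: (boolP (k \in A)) => [kA|]; last first.
  by rewrite inE negb_or => /andP[/ms_coef_out -> /ms_coef_out ->].
have : b (val k) = 0.
  apply: b0; last by apply: map_f.
    by rewrite map_inj_uniq ?fset_uniq //; apply: val_inj.
  by move=> _ /mapP[j _ ->]; apply: Malg; apply: valP.
by rewrite bE => /eqP; rewrite subr_eq0 => /eqP [].
Qed.

Lemma exp_eval_bij : bijective exp_eval.
Proof.
have [h hK] := choice exp_eval_surj.
by exists h => // f; apply: exp_eval_inj; rewrite hK.
Qed.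

End ExpEval.

Theorem proposition4p2 (R : realType) (M : addrClosed R)
    (Mpos : forall x : R, x \in M -> 0 <= x)
    (Malg : forall x : R, x \in M -> algebraicOver (ratr : rat -> R) x) :
  semiring_isomorphic (expSemiring M) (monoidSemiring nat (submonoid M)).
Proof. exact: semiring_isomorphic_sym (exp_eval_bij Malg). Qed.
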